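(* Let $G$ be a finite simple connected bipartite graph of order at least three. Then $$\left\lfloor\frac{D'(G)}{2}\right\rfloor \leq OD'^-(G) \leq \left\lfloor\frac{D'(G)}{2}\right\rfloor+1$$ and $$D'(G)-1\leq OD'^+(G)\leq D'(G).$$
   Context: Write $[k]=\{1,\ldots,k\}$. For a graph $G$, an edge colouring $c\colon E(G)\to[k]$ (not necessarily proper) breaks an automorphism $\varphi\in\operatorname{Aut}(G)$ if some edge $xy$ satisfies $c(\varphi(x)\varphi(y))\neq c(xy)$; it is distinguishing if it breaks every non-trivial automorphism of $G$. The distinguishing index $D'(G)$ is the least integer $k\ge 1$ for which $G$ has a distinguishing colouring $E(G)\to[k]$. For a digraph, automorphisms preserve arcs together with their directions, and distinguishing arc colourings and the distinguishing index $D'$ are defined in the same way with arcs in place of edges. An orientation of $G$ is a digraph $\overrightarrow{G}$ obtained from $G$ by replacing each edge $xy$ with exactly one of the arcs $\overrightarrow{xy}$, $\overrightarrow{yx}$. Define $OD'^-(G)=\min D'(\overrightarrow{G})$ and $OD'^+(G)=\max D'(\overrightarrow{G})$, both over all orientations $\overrightarrow{G}$ of $G$. *)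

(* Defs.v *)
From mathcomp Require Import all_boot all_fingroup.
From mathcomp Require Import boolp.

Set Implicit Arguments.
Unset Strict Implicit.
Unset Printing Implicit Defensive.

(* The value 0 when P is never satisfied is a dummy. *)
Definition least (P : pred nat) : nat :=
  if pselect (exists n, P n) is left exP then ex_minn exP else 0.

Lemma leastP (P : pred nat) (m : nat) :
  P m -> (forall n, P n -> m <= n) -> least P = m.
Proof.
move=> Pm m_min; rewrite /least; case: pselect => [exP|[]]; last by exists m.
case: ex_minnP => n Pn n_min.
by apply/eqP; rewrite eqn_leq n_min // m_min.
Qed.

Record sgraph (T : finType) := SGraph {
  adj :> rel T;
  adj_sym : symmetric adj;
  adj_irrefl : irreflexive adj
}.

Definition connected (T : finType) (G : sgraph T) : Prop :=
  forall x y : T, connect G x y.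

Definition bipartite (T : finType) (G : sgraph T) : Prop :=
  exists A : {set T}, forall x y : T, G x y -> (x \in A) != (y \in A).

Definition graph_aut (T : finType) (G : sgraph T) (phi : {perm T}) : bool :=
  [forall x, forall y, G (phi x) (phi y) == G x y].

(* An edge colouring is a function on all of {set T}, the edge xy being the set
   [set x; y]. Its values on sets that are not edges are never inspected, so
   for k > 0 this amounts to a colouring of the edges alone. *)
Definition edge_breaks (T : finType) (G : sgraph T) (k : nat)
    (c : {ffun {set T} -> 'I_k}) (phi : {perm T}) : bool :=
  [exists x, exists y, G x y && (c [set phi x; phi y] != c [set x; y])].

Definition edge_distinguishing (T : finType) (G : sgraph T) (k : nat)
    (c : {ffun {set T} -> 'I_k}) : bool :=
  [forall phi : {perm T},
     graph_aut G phi && (phi != 1%g) ==> edge_breaks G c phi].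

Definition dist_index (T : finType) (G : sgraph T) : nat :=
  least (fun k => (0 < k) &&
    [exists c : {ffun {set T} -> 'I_k}, edge_distinguishing G c]).

(* A digraph on T is given by its set of arcs; (x, y) is the arc from x to y. *)
Definition digraph (T : finType) := {set T * T}.

Definition digraph_aut (T : finType) (D : digraph T) (phi : {perm T}) : bool :=
  [forall x, forall y, ((phi x, phi y) \in D) == ((x, y) \in D)].

(* As for edges, the values of an arc colouring outside D are irrelevant. *)
Definition arc_breaks (T : finType) (D : digraph T) (k : nat)
    (c : {ffun T * T -> 'I_k}) (phi : {perm T}) : bool :=
  [exists x, exists y, ((x, y) \in D) && (c (phi x, phi y) != c (x, y))].

Definition arc_distinguishing (T : finType) (D : digraph T) (k : nat)
    (c : {ffun T * T -> 'I_k}) : bool :=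
  [forall phi : {perm T},
     digraph_aut D phi && (phi != 1%g) ==> arc_breaks D c phi].

Definition arc_dist_index (T : finType) (D : digraph T) : nat :=
  least (fun k => (0 < k) &&
    [exists c : {ffun T * T -> 'I_k}, arc_distinguishing D c]).

Definition orientation (T : finType) (G : sgraph T) (D : digraph T) : bool :=
  [forall x, forall y,
     if G x y then ((x, y) \in D) (+) ((y, x) \in D) else (x, y) \notin D].

Definition OD_min (T : finType) (G : sgraph T) : nat :=
  least (fun k =>
    [exists D : digraph T, orientation G D && (arc_dist_index D == k)]).

Definition OD_max (T : finType) (G : sgraph T) : nat :=
  \max_(D : digraph T | orientation G D) arc_dist_index D.

(* Main.v *)
Require Import Defs.
From mathcomp Require Import all_boot.
From mathcomp Require Import all_fingroup boolp zify.

Set Implicit Arguments.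
Unset Strict Implicit.
Unset Printing Implicit Defensive.

(** The common tool is the following remark about a connected bipartite graph
    with sides [A] and its complement. An automorphism either keeps both sides
    or swaps them ([aut_keeps_or_swaps]). Suppose that a colouring is preserved
    by no non-trivial automorphism that keeps the sides. The product of two
    automorphisms that swap the sides and preserve the colours keeps the sides,
    hence is trivial; so at most one non-trivial automorphism [phi] preserves
    the colours. Giving one extra colour to a single edge moved by [phi]
    therefore yields a distinguishing colouring
    ([dist_index_le_of_side_rigid]).

    Lower bounds. An arc colouring together with the direction of each arc,
    from [A] or towards [A], is an edge colouring with twice as many colours. If
    the arc colouring is distinguishing, then no non-trivial automorphism that
    keeps the sides preserves the edge colouring, so that [D'(G)] is at most
    [2 D'(D) + 1] for every orientation [D]. If all arcs leave [A], the direction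
    carries no information, and [D'(G)] is at most [D'(D) + 1].

    Upper bounds. A distinguishing edge colouring of [G] is distinguishing on
    every orientation, which bounds [OD'^+]. For [OD'^-], read the edge colours
    [1, ..., d] in binary: the last bit gives the direction of the arc relative
    to [A], and the other bits give its colour, which is at most [d / 2]. As [0]
    is not used, the arcs of colour [0] all leave [A]; there is at least one
    of them after a renaming of the colours. Hence no automorphism of the
    coloured orientation swaps the sides, and one that keeps them preserves
    the edge colours ([exists_orientation_half]). *)

(** * Least elements and two-element sets *)

Lemma least_ex (P : pred nat) n : P n -> P (least P).
Proof.
move=> Pn; rewrite /least; case: pselect => [exP|[]]; last by exists n.
by case: ex_minnP.
Qed.

Lemma least_le (P : pred nat) n : P n -> least P <= n.
Proof.
move=> Pn; rewrite /least; case: pselect => // exP.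
by case: ex_minnP => m _; apply.
Qed.

Lemma set2_eq (T : finType) (x y u v : T) :
  [set x; y] = [set u; v] -> (x = u /\ y = v) \/ (x = v /\ y = u).
Proof.
move=> E; have xE : x \in [set u; v] by rewrite -E set21.
have yE : y \in [set u; v] by rewrite -E set22.
have uE : u \in [set x; y] by rewrite E set21.
have vE : v \in [set x; y] by rewrite E set22.
case/set2P: xE => ?; case/set2P: yE => ?; subst; auto.
- by move: vE; rewrite !inE orbb => /eqP->; auto.
- by move: uE; rewrite !inE orbb => /eqP->; auto.
Qed.

(** * Colourings as functions of two vertices *)

(** Edge colourings are handled below as symmetric functions of the two ends,
    so that edge and arc colourings are objects of the same kind. *)
Definition colour_aut (T : finType) (G : sgraph T) (f : T -> T -> nat)
    (phi : {perm T}) : Prop :=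
  graph_aut G phi /\ forall x y, G x y -> f (phi x) (phi y) = f x y.

Definition edge_rigid (T : finType) (G : sgraph T) (f : T -> T -> nat) : Prop :=
  forall phi, colour_aut G f phi -> phi = 1%g.

Definition arc_rigid (T : finType) (D : digraph T) (g : T -> T -> nat) : Prop :=
  forall phi, digraph_aut D phi ->
  (forall x y, (x, y) \in D -> g (phi x) (phi y) = g x y) -> phi = 1%g.

Lemma graph_autE (T : finType) (G : sgraph T) phi x y :
  graph_aut G phi -> G (phi x) (phi y) = G x y.
Proof. by move/forallP/(_ x)/forallP/(_ y)/eqP. Qed.

Lemma digraph_autE (T : finType) (D : digraph T) phi x y :
  digraph_aut D phi -> ((phi x, phi y) \in D) = ((x, y) \in D).
Proof. by move/forallP/(_ x)/forallP/(_ y)/eqP. Qed.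

Lemma colour_autM (T : finType) (G : sgraph T) f phi psi :
  colour_aut G f phi -> colour_aut G f psi -> colour_aut G f (phi * psi)%g.
Proof.
move=> [phiG phif] [psiG psif]; split=> [|x y Gxy].
  by apply/forallP=> x; apply/forallP=> y; rewrite !permM !graph_autE.
by rewrite !permM psif ?phif // graph_autE.
Qed.

(** [dist_index G] is [least (edge_colourable G)] by conversion, and
    [arc_dist_index D] is [least (arc_colourable D)]; the two lemmas below
    translate these predicates into the language of rigid functions. *)
Definition edge_colourable (T : finType) (G : sgraph T) (k : nat) : bool :=
  (0 < k) && [exists c : {ffun {set T} -> 'I_k}, edge_distinguishing G c].

Definition arc_colourable (T : finType) (D : digraph T) (k : nat) : bool :=
  (0 < k) && [exists c : {ffun T * T -> 'I_k}, arc_distinguishing D c].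

Lemma edge_colouringP (T : finType) (G : sgraph T) k :
  reflect (0 < k /\ exists f, [/\ forall x y, f x y = f y x,
             forall x y, f x y < k & edge_rigid G f])
    (edge_colourable G k).
Proof.
case: k => [|k]; first by constructor=> -[].
rewrite /edge_colourable ltn0Sn /=.
apply: (iffP existsP) => [[c /forallP cG]|[_ [f [fC fk frig]]]].
  split=> //; exists (fun x y => c [set x; y] : nat); split.
  - by move=> x y; rewrite setUC.
  - by move=> x y; apply: ltn_ord.
  move=> phi [phiG phic]; apply/eqP/negP=> /negP phi1.
  have /existsP[x /existsP[y /andP[Gxy]]] := implyP (cG phi) (introT andP (conj phiG phi1)).
  by apply/negP; rewrite negbK; apply/eqP/val_inj/phic.
(* Any ordering of the ends of an edge serves, since f is symmetric. *)
pose c : {ffun {set T} -> 'I_k.+1} := [ffun S : {set T} =>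
  if [pick p : T * T | S == [set p.1; p.2]] is Some p
  then inord (f p.1 p.2) else ord0].
have cE x y : c [set x; y] = f x y :> nat.
  rewrite ffunE; case: pickP => [[u v] /= /eqP|/(_ (x, y))]; last by rewrite eqxx.
  by move/set2_eq=> [[-> ->]|[-> ->]]; rewrite inordK // ?[f v u]fC.
exists c; apply/forallP=> phi; apply/implyP=> /andP[phiG].
apply: contraNT => /existsPn nbr; apply/eqP/frig; split=> // x y Gxy.
have /existsPn/(_ y) := nbr x.
by rewrite Gxy negbK => /eqP/(congr1 val) /=; rewrite !cE.
Qed.

Lemma arc_colouringP (T : finType) (D : digraph T) k :
  reflect (0 < k /\ exists2 g, forall x y, g x y < k & arc_rigid D g)
    (arc_colourable D k).
Proof.
case: k => [|k]; first by constructor=> -[].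
rewrite /arc_colourable ltn0Sn /=.
apply: (iffP existsP) => [[c /forallP cD]|[_ [g gk grig]]].
  split=> //; exists (fun x y => c (x, y) : nat) => [x y|]; first exact: ltn_ord.
  move=> phi phiD phic; apply/eqP/negP=> /negP phi1.
  have /existsP[x /existsP[y /andP[Dxy]]] := implyP (cD phi) (introT andP (conj phiD phi1)).
  by apply/negP; rewrite negbK; apply/eqP/val_inj/phic.
exists [ffun p => inord (g p.1 p.2)].
apply/forallP=> phi; apply/implyP=> /andP[phiD].
apply: contraNT => /existsPn nbr; apply/eqP/grig => // x y Dxy.
have /existsPn/(_ y) := nbr x.
by rewrite Dxy negbK !ffunE => /eqP/(congr1 val) /=; rewrite !inordK.
Qed.

Lemma dist_index_le (T : finType) (G : sgraph T) k f :
  0 < k -> (forall x y, f x y = f y x) -> (forall x y, f x y < k) ->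
  edge_rigid G f -> dist_index G <= k.
Proof.
by move=> k0 fC fk frig; apply: (least_le (P := edge_colourable G)); apply/edge_colouringP; split; last exists f.
Qed.

Lemma arc_dist_index_le (T : finType) (D : digraph T) k g :
  0 < k -> (forall x y, g x y < k) -> arc_rigid D g -> arc_dist_index D <= k.
Proof.
by move=> k0 gk grig; apply: (least_le (P := arc_colourable D)); apply/arc_colouringP; split; last exists g.
Qed.

(** * Automorphisms that fix every edge *)

(** If [phi x] differs from [x], every edge at [x] joins it to [phi x], and
    likewise every edge at [phi x] joins it to [x]; by connectedness the graph
    is then reduced to one edge. *)
Lemma edge_fixing_aut_trivial (T : finType) (G : sgraph T) (phi : {perm T}) :
  connected G -> 2 < #|T| ->
  (forall x y, G x y -> [set phi x; phi y] = [set x; y]) -> phi = 1%g.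
Proof.
move=> Gc T3 fixE; apply/permP=> x; rewrite perm1.
apply/eqP; apply: contraTT T3 => xx; rewrite -leqNgt.
have nbr z y : phi z != z -> G z y -> y = phi z /\ phi y = z.
  move=> zz /fixE /set2_eq[[E]|[-> ->]] //; by rewrite E eqxx in zz.
have cl : closed G [set x; phi x].
  apply: intro_closed; first exact/sym_connect_sym/adj_sym.
  move=> z y Gzy; rewrite !inE => /orP[]/eqP E; subst z.
    by have [-> _] := nbr _ _ xx Gzy; rewrite eqxx orbT.
  have ppx : phi (phi x) != phi x by rewrite (inj_eq perm_inj).
  by have [_ /perm_inj->] := nbr _ _ ppx Gzy; rewrite eqxx.
have /subset_leq_card : [set: T] \subset [set x; phi x].
  by apply/subsetP=> y _; rewrite -(closed_connect cl (Gc x y)) set21.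
by rewrite cardsT cards2; move/leq_trans; apply; case: (_ != _).
Qed.

Lemma exists_edge (T : finType) (G : sgraph T) :
  connected G -> 2 < #|T| -> exists x y, G x y.
Proof.
move=> Gc T3; have /card_gt1P[x [y [_ _ xy]]] : 1 < #|T| := ltnW T3.
have /connectP[[|w p] /=] := Gc x y; first by move=> _ E; rewrite E eqxx in xy.
by case/andP=> Gxw _ _; exists x, w.
Qed.

(** Giving distinct colours to all edges is distinguishing, so [least] is not
    at its dummy value here. *)
Lemma dist_index_attained (T : finType) (G : sgraph T) :
  connected G -> 2 < #|T| ->
  0 < dist_index G /\ exists f, [/\ forall x y, f x y = f y x,
    forall x y, f x y < dist_index G & edge_rigid G f].
Proof.
move=> Gc T3; apply/edge_colouringP.
apply: (least_ex (P := edge_colourable G) (n := #|{: {set T}}|)).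
apply/edge_colouringP; split; first by rewrite (cardD1 set0).
exists (fun x y => enum_rank [set x; y] : nat); split.
- by move=> x y; rewrite setUC.
- by move=> x y; apply: ltn_ord.
move=> phi [_ phif]; apply: edge_fixing_aut_trivial => // x y Gxy.
exact/enum_rank_inj/val_inj/phif.
Qed.

(** * Orientations *)

Lemma orientation_adj (T : finType) (G : sgraph T) (D : digraph T) x y :
  orientation G D -> G x y = ((x, y) \in D) || ((y, x) \in D).
Proof.
move=> GD; have := forallP (forallP GD x) y; have := forallP (forallP GD y) x.
rewrite [G y x]adj_sym; case: (G x y).
  by case: ((x, y) \in D); case: ((y, x) \in D).
by move/negPf-> => /negPf->.
Qed.

Lemma orientation_anti (T : finType) (G : sgraph T) (D : digraph T) x y :
  orientation G D -> (x, y) \in D -> (y, x) \notin D.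
Proof.
move=> GD Dxy; have := forallP (forallP GD x) y.
by rewrite (orientation_adj _ _ GD) Dxy /=; case: (_ \in D).
Qed.

Lemma digraph_aut_graph_aut (T : finType) (G : sgraph T) (D : digraph T) phi :
  orientation G D -> digraph_aut D phi -> graph_aut G phi.
Proof.
move=> GD phiD; apply/forallP=> x; apply/forallP=> y.
by rewrite !(orientation_adj _ _ GD) !digraph_autE.
Qed.

Lemma graph_aut_digraph_aut (T : finType) (G : sgraph T) (D : digraph T) phi :
  orientation G D -> graph_aut G phi ->
  (forall x y, (x, y) \in D -> (phi x, phi y) \in D) -> digraph_aut D phi.
Proof.
move=> GD phiG phiD; apply/forallP=> x; apply/forallP=> y; apply/eqP.
apply/idP/idP=> [Dp|]; last exact: phiD.
have : G x y by rewrite -(graph_autE _ _ phiG) (orientation_adj _ _ GD) Dp.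
rewrite (orientation_adj _ _ GD) => /orP[] // /phiD.
by rewrite (negPf (orientation_anti GD Dp)).
Qed.

Lemma arc_rigid_of_edge_rigid (T : finType) (G : sgraph T) (D : digraph T) f :
  orientation G D -> (forall x y, f x y = f y x) ->
  edge_rigid G f -> arc_rigid D f.
Proof.
move=> GD fC frig phi phiD phif; apply: frig; split=> [|x y].
  exact: digraph_aut_graph_aut phiD.
by rewrite (orientation_adj _ _ GD) => /orP[]/phif //; rewrite fC [f y x]fC.
Qed.

Lemma arc_dist_index_le_dist_index (T : finType) (G : sgraph T) (D : digraph T) :
  connected G -> 2 < #|T| -> orientation G D ->
  arc_dist_index D <= dist_index G.
Proof.
move=> Gc T3 GD; have [d0 [f [fC fd frig]]] := dist_index_attained Gc T3.
exact: arc_dist_index_le (arc_rigid_of_edge_rigid GD fC frig).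
Qed.

Lemma arc_dist_index_attained (T : finType) (G : sgraph T) (D : digraph T) :
  connected G -> 2 < #|T| -> orientation G D ->
  0 < arc_dist_index D /\
  exists2 g, forall x y, g x y < arc_dist_index D & arc_rigid D g.
Proof.
move=> Gc T3 GD; apply/arc_colouringP.
apply: (least_ex (P := arc_colourable D) (n := dist_index G)).
have [d0 [f [fC fd frig]]] := dist_index_attained Gc T3.
apply/arc_colouringP; split=> //; exists f => //.
exact: arc_rigid_of_edge_rigid GD fC frig.
Qed.

(** * Automorphisms and the two sides *)

Definition sides (T : finType) (G : sgraph T) (A : {set T}) : Prop :=
  forall x y, G x y -> (x \in A) != (y \in A).

Definition keeps_sides (T : finType) (A : {set T}) (phi : {perm T}) : Prop :=
  forall x, (phi x \in A) = (x \in A).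

Definition swaps_sides (T : finType) (A : {set T}) (phi : {perm T}) : Prop :=
  forall x, (phi x \in A) = (x \notin A).

Definition side_rigid (T : finType) (G : sgraph T) (A : {set T})
    (f : T -> T -> nat) : Prop :=
  forall phi, colour_aut G f phi -> keeps_sides A phi -> phi = 1%g.

Lemma sidesN (T : finType) (G : sgraph T) (A : {set T}) x y :
  sides G A -> G x y -> (y \in A) = (x \notin A).
Proof. by move=> AG /AG; case: (x \in A); case: (y \in A). Qed.

(** Along an edge both [x \in A] and [phi x \in A] change, so whether the two
    agree is constant on a connected graph. *)
Lemma aut_keeps_or_swaps (T : finType) (G : sgraph T) (A : {set T}) phi :
  connected G -> sides G A -> graph_aut G phi ->
  keeps_sides A phi \/ swaps_sides A phi.
Proof.
move=> Gc AG phiG.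
pose B := [set x | (phi x \in A) == (x \in A)].
have cl : closed G B.
  move=> x y Gxy; rewrite !inE (sidesN AG Gxy).
  have -> : (phi y \in A) = (phi x \notin A) by apply: (sidesN AG); rewrite ?graph_autE.
  by case: (_ \in A); case: (_ \in A).
have [[x0 x0B]|noB] := pselect (exists x, x \in B).
  by left=> x; have := x0B; rewrite (closed_connect cl (Gc x0 x)) inE => /eqP.
right=> x; have : x \notin B by apply/negP=> xB; apply: noB; exists x.
by rewrite inE; case: (_ \in A); case: (_ \in A).
Qed.

(** Two colour automorphisms that swap the sides are inverse to each other, so
    there is at most one of them, and recolouring an edge that it moves
    destroys it. The new colour pins down that edge, so an automorphism for the
    new colours preserves the old ones too. *)
Lemma dist_index_le_of_side_rigid (T : finType) (G : sgraph T) (A : {set T}) k f :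
  connected G -> 2 < #|T| -> sides G A ->
  (forall x y, f x y = f y x) -> (forall x y, f x y < k) ->
  side_rigid G A f -> dist_index G <= k.+1.
Proof.
move=> Gc T3 AG fC fk frig.
have [frig1|] := pselect (edge_rigid G f).
  by apply: (dist_index_le (f := f)) => // x y; rewrite ltnS ltnW.
move/existsNP=> [phi /not_implyP[phif phi1]].
have side psi : colour_aut G f psi -> psi <> 1%g -> swaps_sides A psi.
  move=> psif psi1; have [psiA|] // := aut_keeps_or_swaps Gc AG (proj1 psif).
  by case: psi1; apply: frig.
have [u [v [Guv uv]]] : exists u v, G u v /\ [set phi u; phi v] <> [set u; v].
  apply: contrapT => noE; apply: phi1; apply: edge_fixing_aut_trivial => // x y Gxy.
  by apply: contrapT => xy; apply: noE; exists x, y.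
pose f' x y := if [set x; y] == [set u; v] then k else f x y.
have f'k x y : (f' x y == k) = ([set x; y] == [set u; v]).
  by rewrite /f'; case: ifP => _; rewrite ?eqxx // ltn_eqF.
apply: (dist_index_le (f := f')) => //.
- by move=> x y; rewrite /f' setUC fC.
- by move=> x y; rewrite /f'; case: ifP => // _; rewrite ltnS ltnW.
move=> psi [psiG psif'].
have psiE x y : G x y ->
    ([set psi x; psi y] == [set u; v]) = ([set x; y] == [set u; v]).
  by move=> Gxy; rewrite -!f'k psif'.
have psif : colour_aut G f psi.
  split=> // x y Gxy; have := psif' _ _ Gxy; have := psiE _ _ Gxy.
  rewrite /f' => ->; case: ifP => // /eqP E _.
  have E' : [set psi x; psi y] = [set u; v] by apply/eqP; rewrite psiE // E.
  have fE a b : [set a; b] = [set u; v] -> f a b = f u v.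
    by case/set2_eq=> [[-> ->]|[-> ->]].
  by rewrite !fE.
apply: contrapT => psi1.
have mul1 sigma : colour_aut G f sigma -> swaps_sides A sigma ->
    (sigma * phi = 1)%g.
  move=> sf sA; apply: frig; first exact: colour_autM.
  by move=> x; rewrite permM (side _ phif phi1) sA negbK.
have psiphi : psi = phi.
  by apply: (mulIg phi); rewrite !mul1 //; apply: side.
by apply: uv; apply/eqP; rewrite -psiphi psiE.
Qed.

(** * Lower bounds on the distinguishing indices of orientations *)

Definition forget_direction (T : finType) (D : digraph T)
    (g : T -> T -> nat) (x y : T) : nat :=
  if (x, y) \in D then g x y else if (y, x) \in D then g y x else 0.

Lemma forget_directionC (T : finType) (G : sgraph T) (D : digraph T) g x y :
  orientation G D -> forget_direction D g x y = forget_direction D g y x.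
Proof.
move=> GD; rewrite /forget_direction; case: ifP => // Dxy.
by rewrite (negPf (orientation_anti GD Dxy)).
Qed.

Lemma forget_direction_lt (T : finType) (D : digraph T) g k x y :
  0 < k -> (forall x y, g x y < k) -> forget_direction D g x y < k.
Proof. by move=> k0 gk; rewrite /forget_direction; do 2?case: ifP. Qed.

(** If [phi] keeps the sides and reverses an arc, then it changes the direction
    of that arc relative to [A], hence the parity of its colour. *)
Lemma dist_index_le_double (T : finType) (G : sgraph T) (D : digraph T) :
  connected G -> bipartite G -> 2 < #|T| -> orientation G D ->
  dist_index G <= (arc_dist_index D).*2.+1.
Proof.
move=> Gc [A AG] T3 GD.
have [k0 [g gk grig]] := arc_dist_index_attained Gc T3 GD.
(* The colour of an arc with a parity bit for its direction relative to A. *)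
pose h x y := (x \in A) + (g x y).*2.
have fE x y : (x, y) \in D -> forget_direction D h x y = h x y.
  by rewrite /forget_direction => ->.
apply: (dist_index_le_of_side_rigid (A := A) (f := forget_direction D h)) => //.
- by move=> x y; exact: (forget_directionC _ _ _ GD).
- move=> x y; apply: forget_direction_lt; first by rewrite double_gt0.
  by move=> a b; rewrite /h; have := gk a b; case: (a \in A); lia.
move=> phi [phiG phif] phiA.
have Dphi x y : (x, y) \in D -> (phi x, phi y) \in D.
  move=> Dxy; have Gxy : G x y by rewrite (orientation_adj _ _ GD) Dxy.
  have : G (phi x) (phi y) by rewrite graph_autE.
  rewrite (orientation_adj _ _ GD) => /orP[] // Dyx.
  have := phif _ _ Gxy; rewrite (forget_directionC _ _ _ GD) !fE //.
  move/(congr1 odd); rewrite /h !oddD !odd_double phiA (sidesN AG Gxy).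
  by case: (x \in A).
apply: grig => [|x y Dxy]; first exact: graph_aut_digraph_aut GD phiG Dphi.
have Gxy : G x y by rewrite (orientation_adj _ _ GD) Dxy.
have := phif _ _ Gxy; rewrite !fE ?Dphi // /h phiA.
by move/addnI/double_inj.
Qed.

Definition side_orientation (T : finType) (G : sgraph T) (A : {set T}) :
  digraph T := [set p | G p.1 p.2 && (p.1 \in A)].

Lemma side_orientationP (T : finType) (G : sgraph T) (A : {set T}) :
  sides G A -> orientation G (side_orientation G A).
Proof.
move=> AG; apply/forallP=> x; apply/forallP=> y; rewrite !inE /= [G y x]adj_sym.
by case Gxy: (G x y) => //=; rewrite (sidesN AG Gxy); case: (_ \in A).
Qed.

Lemma dist_index_le_side_orientation (T : finType) (G : sgraph T) (A : {set T}) :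
  connected G -> 2 < #|T| -> sides G A ->
  dist_index G <= (arc_dist_index (side_orientation G A)).+1.
Proof.
move=> Gc T3 AG; have GD := side_orientationP AG.
have [k0 [g gk grig]] := arc_dist_index_attained Gc T3 GD.
set D := side_orientation G A in GD k0 g gk grig *.
apply: (dist_index_le_of_side_rigid (A := A) (f := forget_direction D g)) => //.
- by move=> x y; exact: (forget_directionC _ _ _ GD).
- by move=> x y; apply: forget_direction_lt.
move=> phi [phiG phif] phiA.
have phiD : digraph_aut D phi.
  by apply/forallP=> x; apply/forallP=> y; rewrite !inE /= graph_autE ?phiA.
apply: grig => // x y Dxy.
have Gxy : G x y by rewrite (orientation_adj _ _ GD) Dxy.
by have := phif _ _ Gxy; rewrite /forget_direction digraph_autE ?Dxy.
Qed.

(** * An orientation of small distinguishing index *)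

(** Avoiding the colour [0] leaves the partner [0] of [1] in the pairing of [2i]
    with [2i + 1] unused, and [e u v = 1] makes sure that [1] itself occurs; this
    asymmetry is what excludes a swap of the sides. *)
Lemma shifted_colouring (T : finType) (G : sgraph T) d f u v :
  (forall x y, f x y = f y x) -> (forall x y, f x y < d) -> edge_rigid G f ->
  exists e, [/\ forall x y, e x y = e y x, forall x y, 0 < e x y <= d,
    edge_rigid G e & e u v = 1].
Proof.
move=> fC fd frig; set a := f u v.
pose s i := if i == a then 1 else if i == 0 then a.+1 else i.+1.
have s_inj : injective s.
  by move=> i j; rewrite /s; do 4?case: eqP; lia.
exists (fun x y => s (f x y)); split.
- by move=> x y; rewrite fC.
- by move=> x y; have := fd x y; have := fd u v; rewrite /s -/a; do 2?case: eqP; lia.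
- by move=> phi [phiG phis]; apply: frig; split=> // x y /phis/s_inj.
by rewrite /s eqxx.
Qed.

Lemma exists_orientation_half (T : finType) (G : sgraph T) :
  connected G -> bipartite G -> 2 < #|T| ->
  exists2 D : digraph T, orientation G D &
    arc_dist_index D <= (dist_index G)./2.+1.
Proof.
move=> Gc [A AG] T3.
have [d0 [f [fC fd frig]]] := dist_index_attained Gc T3.
have [u [v Guv]] := exists_edge Gc T3.
have [e [eC ed erig euv]] := shifted_colouring u v fC fd frig.
pose D : digraph T := [set p | G p.1 p.2 && (odd (e p.1 p.2) == (p.1 \in A))].
have DE x y : ((x, y) \in D) = G x y && (odd (e x y) == (x \in A)) by rewrite inE.
have GD : orientation G D.
  apply/forallP=> x; apply/forallP=> y; rewrite !DE [G y x]adj_sym [e y x]eC.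
  by case Gxy: (G x y) => //=; rewrite (sidesN AG Gxy); case: odd; case: (_ \in A).
exists D => //; apply: (arc_dist_index_le (g := fun x y => (e x y)./2)) => //.
  by move=> x y; have /andP[_ exy] := ed x y; rewrite ltnS half_leq.
move=> phi phiD phie.
have phiG : graph_aut G phi := digraph_aut_graph_aut GD phiD.
have [phiA|phiA] := aut_keeps_or_swaps Gc AG phiG.
  have arcE x y : (x, y) \in D -> e (phi x) (phi y) = e x y.
    move=> Dxy; have := Dxy; rewrite -(digraph_autE _ _ phiD) DE phiA.
    have := Dxy; rewrite DE => /andP[_ /eqP o] /andP[_ /eqP o'].
    by rewrite -[LHS]odd_double_half -[RHS]odd_double_half phie // o o'.
  apply: erig; split=> // x y.
  by rewrite (orientation_adj _ _ GD) => /orP[]/arcE //; rewrite eC [e y x]eC.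
(* The arc between u and v leaves A and has colour 0, which forces the colour
   of its image, nonzero as an edge colour, to be 1 as well. *)
have no_arc x y : (x, y) \in D -> e x y <> 1.
  move=> Dxy exy; have := phie _ _ Dxy; have := Dxy.
  rewrite -(digraph_autE _ _ phiD) DE phiA; have := Dxy; rewrite DE exy /=.
  have /andP[] := ed (phi x) (phi y).
  by case: (e _ _) => [|[|n]] //= _ _ /andP[_ /eqP<-] /andP[_].
have := Guv; rewrite (orientation_adj _ _ GD) => /orP[]/no_arc //.
by rewrite eC.
Qed.

(** * The bounds *)

Theorem theorem7 (T : finType) (G : sgraph T)
  (Gconn : connected G) (Gbip : bipartite G) (Gord : 3 <= #|T|) :
  (dist_index G %/ 2 <= OD_min G <= dist_index G %/ 2 + 1) /\
  (dist_index G - 1 <= OD_max G <= dist_index G).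
Proof.
have [D GD Dhalf] := exists_orientation_half Gconn Gbip Gord.
pose attained k := [exists D' : digraph T, orientation G D' &&
    (arc_dist_index D' == k)].
have attainedD : attained (arc_dist_index D).
  by apply/existsP; exists D; rewrite GD eqxx.
split; rewrite ?divn2; apply/andP; split.
- have /existsP[E /andP[GE /eqP <-]] : attained (OD_min G) := least_ex attainedD.
  by have := half_leq (dist_index_le_double Gconn Gbip Gord GE); rewrite /= uphalf_double.
- by rewrite addn1; apply: leq_trans Dhalf; apply: (least_le attainedD).
- have [A AG] := Gbip; rewrite leq_subLR add1n.
  apply: leq_trans (dist_index_le_side_orientation Gconn Gord AG) _.
  by rewrite ltnS; apply: (leq_bigmax_cond _ (side_orientationP AG)).
- by apply/bigmax_leqP=> E GE; apply: arc_dist_index_le_dist_index.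
Qed.
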